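(* Let $n$ and $s$ be positive integers, $\zeta_n=e^{2\pi\sqrt{-1}/n}$, and $\mathfrak Z_n(\zeta_n;;s)=\sum_{i=1}^{n-1}\frac{1}{(1-\zeta_n^i)^s}$. Then $$\mathfrak Z_n(\zeta_n;;s)=\frac{(-1)^s n^{s+1}}{(s+1)!}\left(\beta_{s+1}\left(\frac{n-1}{n}\,\Big|\,\frac{1}{n}\right)-\beta_{s+1}\left(0\,\Big|\,\frac{1}{n}\right)\right).$$
   Context: The degenerate Bernoulli polynomials $\beta_k(x|\lambda)$ (Carlitz) are defined by $\dfrac{t(1+\lambda t)^{x/\lambda}}{(1+\lambda t)^{1/\lambda}-1}=\sum_{k=0}^\infty\beta_k(x|\lambda)\dfrac{t^k}{k!}$. *)

(* Defs.v *)
From HB Require Import structures.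
From mathcomp Require Import all_boot all_order all_algebra.
From mathcomp Require Import complex.
From mathcomp Require Import all_classical all_reals all_analysis.

Set Implicit Arguments.
Unset Strict Implicit.
Unset Printing Implicit Defensive.

Import Order.TTheory GRing.Theory Num.Theory.

Local Open Scope ring_scope.
Local Open Scope complex_scope.

(* A formal power series in t over F is its coefficient sequence nat -> F. *)
Section FormalPowerSeries.
Variable F : fieldType.
Implicit Types f g : nat -> F.

Definition fps_one : nat -> F := fun k => (k == 0%N)%:R.

Definition fps_sub f g : nat -> F := fun k => f k - g k.

Definition fps_mul f g : nat -> F :=
  fun k => \sum_(i < k.+1) f i * g (k - i)%N.

Definition fps_mulX f : nat -> F := fun k => if k is j.+1 then f j else 0.

(* (f - f 0) / t *)
Definition fps_divX f : nat -> F := fun k => f k.+1.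

(* The first n coefficients of 1 / f, for f 0 != 0. *)
Fixpoint fps_inv_seq f (n : nat) : seq F :=
  if n is m.+1 then
    let s := fps_inv_seq f m in
    rcons s (((m == 0%N)%:R - \sum_(i < m) s`_i * f (m - i)%N) / f 0%N)
  else [::].

Definition fps_inv f : nat -> F := fun k => (fps_inv_seq f k.+1)`_k.

Definition fps_div f g : nat -> F := fps_mul f (fps_inv g).

(* The series with exponential coefficients b, i.e. \sum_k b k * t^k / k! *)
Definition fps_egf (b : nat -> F) : nat -> F := fun k => b k / k`!%:R.

(* Generalized binomial coefficient a (a - 1) ... (a - k + 1) / k! *)
Definition gbinom (a : F) (k : nat) : F :=
  (\prod_(j < k) (a - j%:R)) / k`!%:R.

(* (1 + lambda t)^a as the binomial series in t *)
Definition fps_binpow (lambda a : F) : nat -> F :=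
  fun k => gbinom a k * lambda ^+ k.

(* beta_k(x | lambda), for lambda != 0:  k! times the coefficient of t^k in
     (1 + lambda t)^(x / lambda) / (((1 + lambda t)^(1 / lambda) - 1) / t).
   dbernoulli_gf and dbernoulli_unique show that this is the sequence
   determined by the generating function
     t (1 + lambda t)^(x / lambda) / ((1 + lambda t)^(1 / lambda) - 1). *)
Definition dbernoulli (k : nat) (x lambda : F) : F :=
  k`!%:R *
  fps_div (fps_binpow lambda (x / lambda))
          (fps_divX (fps_sub (fps_binpow lambda (1 / lambda)) fps_one)) k.

Lemma size_fps_inv_seq f n : size (fps_inv_seq f n) = n.
Proof. by elim: n => //= n IHn; rewrite size_rcons IHn. Qed.

Lemma nth_fps_inv_seq f n k : (k < n)%N -> (fps_inv_seq f n)`_k = fps_inv f k.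
Proof.
elim: n => // n IHn; rewrite ltnS leq_eqVlt => /orP[/eqP->//|ltkn].
by rewrite /= nth_rcons size_fps_inv_seq ltkn IHn.
Qed.

Lemma fps_mulVf f : f 0%N != 0 -> fps_mul (fps_inv f) f =1 fps_one.
Proof.
move=> f0 k; rewrite /fps_mul big_ord_recr /= subnn.
rewrite [X in _ + X * _]/fps_inv /= nth_rcons size_fps_inv_seq ltnn eqxx divfK //.
under [X in _ - X]eq_bigr => i _ do rewrite nth_fps_inv_seq //.
by rewrite addrC subrK.
Qed.

Lemma fps_mulC f g : fps_mul f g =1 fps_mul g f.
Proof.
move=> k; rewrite /fps_mul (reindex_inj rev_ord_inj) /=.
by apply: eq_bigr => i _; rewrite subSS subKn -1?ltnS // mulrC.
Qed.

Lemma fps_mulA f g h : fps_mul f (fps_mul g h) =1 fps_mul (fps_mul f g) h.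
Proof.
move=> k; pose P (u : nat -> F) := \poly_(i < k.+1) u i.
have cP u v m : (m <= k)%N -> (P u * P v)`_m = fps_mul u v m.
  move=> lemk; rewrite coefM; apply: eq_bigr => i _.
  rewrite !coef_poly !ltnS (leq_trans (leq_subr _ _) lemk).
  by rewrite (leq_trans _ lemk) // -ltnS.
have: (P f * (P g * P h))`_k = (P f * P g * P h)`_k by rewrite mulrA.
rewrite 2!coefM => E; rewrite /fps_mul.
transitivity (\sum_(j < k.+1) (P f)`_j * (P g * P h)`_(k - j)).
  by apply: eq_bigr => i _; rewrite cP ?leq_subr // coef_poly ltn_ord.
rewrite E; apply: eq_bigr => i _; rewrite cP -1?ltnS //.
by rewrite coef_poly ltnS leq_subr.
Qed.

Lemma fps_mul1 f : fps_mul fps_one f =1 f.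
Proof.
move=> k; rewrite /fps_mul big_ord_recl /fps_one eqxx mul1r subn0 big1 ?addr0 //.
by move=> i _; rewrite mul0r.
Qed.

Lemma eq_fps_mul f f' g g' :
  f =1 f' -> g =1 g' -> fps_mul f g =1 fps_mul f' g'.
Proof. by move=> ef eg k; apply: eq_bigr => i _; rewrite ef eg. Qed.

Lemma fps_mulXE f g k :
  f 0%N = 0 -> fps_mul f g k = fps_mulX (fps_mul (fps_divX f) g) k.
Proof.
move=> f0; rewrite /fps_mul big_ord_recl f0 mul0r add0r.
by case: k => [|k]; rewrite ?big_ord0.
Qed.

(* For natural m the binomial series is the polynomial (1 + lambda t)^m. *)
Lemma fps_binpow_nat (lambda : F) (m k : nat) : [pchar F] =i pred0 ->
  fps_binpow lambda m%:R k = ((1 + lambda *: 'X) ^+ m)`_k.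
Proof.
move=> F0; have k0 : k`!%:R != 0 :> F.
  by rewrite ((pcharf0P _).1 F0) -lt0n fact_gt0.
have -> : (1 + lambda *: 'X) ^+ m =
          \poly_(i < m.+1) (lambda ^+ i *+ 'C(m, i)).
  rewrite poly_def addrC exprDn_comm; last exact: commr1.
  rewrite (reindex_inj rev_ord_inj) /=; apply: eq_bigr => i _.
  rewrite subSS subKn -1?ltnS // expr1n mulr1 exprZn scalerMnl.
  by rewrite bin_sub -1?ltnS.
rewrite coef_poly /fps_binpow /gbinom.
have -> : \prod_(j < k) (m%:R - j%:R) = (m ^_ k)%:R :> F.
  elim: k {k0} => [|k IHk]; first by rewrite big_ord0.
  rewrite big_ord_recr /= IHk ffactnSr natrM.
  have [lekm|ltmk] := leqP k m; first by rewrite natrB.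
  by rewrite ffact_small // !mul0r.
rewrite -bin_ffact natrM mulfK // mulr_natl ltnS.
by case: leqP => // ltmk; rewrite bin_small.
Qed.

End FormalPowerSeries.

Section DegenerateBernoulli.
Variable F : numFieldType.
Implicit Types (x lambda : F) (b : nat -> F).

Let binpow_sub1_0 lambda :
  fps_sub (fps_binpow lambda (1 / lambda)) (fps_one F) 0 = 0.
Proof.
by rewrite /fps_sub /fps_binpow /gbinom big_ord0 /fps_one eqxx divr1 mul1r subrr.
Qed.

Let binpow_sub1_1 lambda : lambda != 0 ->
  fps_divX (fps_sub (fps_binpow lambda (1 / lambda)) (fps_one F)) 0 != 0.
Proof.
move=> l0; rewrite /fps_divX /fps_sub /fps_binpow /gbinom big_ord_recl big_ord0.
by rewrite /fps_one /= !subr0 mulr1 divr1 mul1r expr1 mulVf ?oner_eq0.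
Qed.

Lemma dbernoulli_gf x lambda : lambda != 0 ->
  fps_mul (fps_sub (fps_binpow lambda (1 / lambda)) (@fps_one F))
          (fps_egf (fun k => dbernoulli k x lambda))
  =1 fps_mulX (fps_binpow lambda (x / lambda)).
Proof.
move=> l0 k; rewrite fps_mulXE //; case: k => //= k.
set h := fps_divX _; set e := fps_binpow _ _.
transitivity (fps_mul h (fps_mul (fps_inv h) e) k).
  apply: eq_fps_mul => // j; rewrite /fps_egf /dbernoulli mulrC mulKf.
    by rewrite [LHS]fps_mulC.
  by rewrite pnatr_eq0 -lt0n fact_gt0.
rewrite fps_mulA (eq_fps_mul (f' := fps_one F) (g' := e)) ?fps_mul1 //.
by move=> j; rewrite fps_mulC fps_mulVf // binpow_sub1_1.
Qed.

Lemma dbernoulli_unique x lambda b : lambda != 0 ->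
  fps_mul (fps_sub (fps_binpow lambda (1 / lambda)) (@fps_one F)) (fps_egf b)
  =1 fps_mulX (fps_binpow lambda (x / lambda)) ->
  forall k, b k = dbernoulli k x lambda.
Proof.
move=> l0 gf_b k.
have k0 : k`!%:R != 0 :> F by rewrite pnatr_eq0 -lt0n fact_gt0.
rewrite /dbernoulli /fps_div; set h := fps_divX _; set e := fps_binpow _ _.
have hb : fps_mul h (fps_egf b) =1 e.
  by move=> j; have := gf_b j.+1; rewrite fps_mulXE.
rewrite [X in _ * X]fps_mulC -(eq_fps_mul (frefl _) hb) fps_mulA.
rewrite (eq_fps_mul (f' := fps_one F) (g' := fps_egf b)) //; last first.
  by apply: fps_mulVf; exact: binpow_sub1_1.
by rewrite fps_mul1 /fps_egf mulrC divfK.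
Qed.

End DegenerateBernoulli.

Section RootsOfUnity.
Variable R : realType.

Definition cexp (z : R[i]) : R[i] :=
  (expR (complex.Re z))%:C *
  (cos (complex.Im z) +i* sin (complex.Im z)).

Definition zeta_root (n : nat) : R[i] :=
  cexp ((2 * pi)%:C * 'i / n%:R).

Lemma zeta_rootE n :
  zeta_root n = cos (2 * pi / n%:R) +i* sin (2 * pi / n%:R).
Proof.
have -> : zeta_root n = cexp (0 +i* (2 * pi / n%:R)).
  rewrite /zeta_root; congr cexp.
  rewrite -(rmorph_nat (real_complex R)) -fmorphV; apply/eqP.
  by rewrite eq_complex /= !(mul0r, mulr0, mul1r, mulr1, subr0, addr0, add0r,
                             oppr0) !eqxx.
by rewrite /cexp /= expR0 mul1r.
Qed.

Definition cyclotomic_sum (n : nat) (zeta : R[i]) (s : nat) : R[i] :=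
  \sum_(1 <= i < n) 1 / (1 - zeta ^+ i) ^+ s.

End RootsOfUnity.

(* Main.v *)
Require Import Defs.
From mathcomp Require Import all_boot all_order all_algebra.
From mathcomp Require Import complex.
From mathcomp Require Import all_classical all_reals all_analysis.
From mathcomp Require Import ring lra.
Import Order.TTheory GRing.Theory Num.Theory.
Local Open Scope ring_scope.
Local Open Scope complex_scope.

(* Put u = t / n.  The series of the differences of the two families of
   degenerate Bernoulli numbers is n u (w^(n-1) - 1) / (w^n - 1) with w = 1 + u,
   and the partial fraction expansion
     n (w^(n-1) - 1) / (w^n - 1) = \sum_zeta (1 - zeta) / (w - zeta)
   over the n-th roots of unity zeta <> 1 is a sum of geometric series in
   - u / (1 - zeta).  Comparing the coefficients of u^s gives the formula. *)

Section ScalarExtension.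
Variables (F K : numFieldType) (f : {rmorphism F -> K}).

Lemma rmorph_fps_binpow (lambda a : F) k :
  f (fps_binpow lambda a k) = fps_binpow (f lambda) (f a) k.
Proof.
rewrite /fps_binpow /gbinom rmorphM rmorphXn fmorph_div rmorph_nat rmorph_prod.
by congr (_ / _ * _); apply: eq_bigr => j _; rewrite rmorphB rmorph_nat.
Qed.

(** Applying [f] to the generating function identity over [F] gives the one over [K], and that
    identity determines the sequence. This lets values over [R] be compared with a computation in
    [R[i]]. *)
Lemma rmorph_dbernoulli (x lambda : F) k : lambda != 0 ->
  f (dbernoulli k x lambda) = dbernoulli k (f x) (f lambda).
Proof.
move=> l0; move: k; apply: (dbernoulli_unique (b := fun k => f (dbernoulli k x lambda))).
  by rewrite fmorph_eq0.
move=> k; have /(congr1 f) := dbernoulli_gf x l0 k.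
have -> : f (fps_mulX (fps_binpow lambda (x / lambda)) k) =
          fps_mulX (fps_binpow (f lambda) (f x / f lambda)) k.
  by case: k => [|k]; rewrite /= ?rmorph0 // rmorph_fps_binpow fmorph_div.
move<-; rewrite /fps_mul rmorph_sum; apply: eq_bigr => i _.
rewrite rmorphM /fps_sub rmorphB rmorph_fps_binpow fmorph_div rmorph1.
by rewrite /fps_one /fps_egf fmorph_div !rmorph_nat.
Qed.

End ScalarExtension.

(** The powers of [- lambda / (1 - z)] are the coefficients of (1 - z) / (1 - z + lambda t), so the
    convolution cancels the linear factor. *)
Lemma geometric_mul_linear (K : fieldType) (Q : {poly K}) (lambda z : K) k :
  z != 1 ->
  \sum_(i < k.+1) (Q * (1 + lambda *: 'X - z%:P))`_i *
                  (- lambda / (1 - z)) ^+ (k - i) = (1 - z) * Q`_k.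
Proof.
move=> z1; have z1' : 1 - z != 0 by rewrite subr_eq0 eq_sym.
have Qi i : (Q * (1 + lambda *: 'X - z%:P))`_i =
    (1 - z) * Q`_i + lambda * (if i is j.+1 then Q`_j else 0).
  rewrite mulrBr mulrDr mulr1 -scalerAr coefB coefD coefZ coefMC coefMX.
  by case: i => [|i] /=; ring.
elim: k => [|k IHk].
  by rewrite big_ord_recl big_ord0 Qi /= mulr0 expr0 !addr0 mulr1.
rewrite big_ord_recr /= subnn expr0 mulr1 Qi.
under eq_bigr => i _ do rewrite subSn -1?ltnS // exprS mulrCA.
by rewrite -mulr_sumr IHk; field.
Qed.

Section RootsOfUnityExpansion.
Variables (K : numFieldType) (n : nat) (z : K).
Hypothesis z_prim : n.-primitive_root z.

Let n_gt0 : (0 < n)%N := prim_order_gt0 z_prim.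

Let n_neq0 : n%:R != 0 :> K. Proof. by rewrite pnatr_eq0 -lt0n. Qed.

Lemma prim_root_power_sum j :
  \sum_(i < n) (z ^+ i) ^+ j = if (n %| j)%N then n%:R else 0.
Proof.
under eq_bigr => i _ do rewrite exprAC.
case: ifP => [/dvdnP[q ->]|ndj].
  under eq_bigr => i _ do
    rewrite mulnC exprM (prim_expr_order z_prim) !expr1n.
  by rewrite sumr_const card_ord.
have zj : z ^+ j - 1 != 0 by rewrite subr_eq0 -(prim_order_dvd z_prim) ndj.
apply: (mulfI zj); rewrite -subrX1 exprAC (prim_expr_order z_prim) expr1n.
by rewrite subrr mulr0.
Qed.

(** This is the partial fraction expansion multiplied by w^n - 1: the inner sum is (w^n - 1) / (w -
    z^i). The coefficient of w^(n-1-j) is the difference of the power sums of exponents j and j + 1,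
    so only j = 0 and j = n - 1 can contribute. *)
Lemma sum_prim_root_cofactor (w : {poly K}) :
  \sum_(i < n) (1 - z ^+ i) *: \sum_(j < n) w ^+ (n.-1 - j) * (z ^+ i)%:P ^+ j
  = n%:R *: (w ^+ n.-1 - 1).
Proof.
under eq_bigr => i _ do rewrite scaler_sumr.
rewrite exchange_big /=.
transitivity (\sum_(j < n) ((if (n %| j)%N then n%:R else 0) -
    (if (n %| j.+1)%N then n%:R else 0)) *: w ^+ (n.-1 - j)).
  apply: eq_bigr => j _; rewrite -!prim_root_power_sum -sumrB scaler_suml.
  apply: eq_bigr => i _.
  by rewrite -rmorphXn mulrC mul_polyC scalerA mulrBl mul1r -exprS.
under eq_bigr => j _ do rewrite scalerBl.
rewrite sumrB scalerBr; case: (n) n_gt0 => // m _; congr (_ - _).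
  rewrite big_ord_recl dvdn0 subn0 big1 ?addr0 // => j _.
  by rewrite lift0 gtnNdvd ?scale0r // ltnS.
rewrite big_ord_recr /= dvdnn subnn expr0 big1 ?add0r // => j _.
by rewrite gtnNdvd ?scale0r // ltnS.
Qed.

Let lambda : K := n%:R^-1.

(* The coefficients of the sum over i of
     lambda t / (1 + lambda t / (1 - z ^+ i)). *)
Let c : nat -> K := fps_mulX (fun k =>
  lambda * \sum_(1 <= i < n) (- lambda / (1 - z ^+ i)) ^+ k).

Lemma prim_root_gf :
  fps_mul (fps_sub (fps_binpow lambda (1 / lambda)) (fps_one K)) c
  =1 fps_mulX (fps_sub (fps_binpow lambda ((n%:R - 1) / n%:R / lambda))
                       (fps_binpow lambda (0 / lambda))).
Proof.
have K0 : [pchar K] =i pred0 by exact: pchar_num.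
have -> : 1 / lambda = n%:R by rewrite /lambda invrK mul1r.
have -> : (n%:R - 1) / n%:R / lambda = n.-1%:R.
  by rewrite /lambda invrK divfK // -subn1 natrB.
have -> : 0 / lambda = 0%:R by rewrite mul0r.
set w : {poly K} := 1 + lambda *: 'X.
(* Since [c] has no constant term, a factor t cancels on both sides. The remaining binomial series
   have exponents n, n - 1 and 0, hence are polynomials in w. *)
move=> k; rewrite fps_mulC fps_mulXE //; case: k => // k.
rewrite [LHS]/= [RHS]/= fps_mulC /fps_sub !fps_binpow_nat // expr0.
rewrite -coefB -/w.
transitivity (lambda * (n%:R *: (w ^+ n.-1 - 1))`_k); last first.
  by rewrite coefZ mulrA mulVf // mul1r.
rewrite -sum_prim_root_cofactor.
rewrite -(big_mkord xpredT (fun i => (1 - z ^+ i) *: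
  \sum_(j < n) w ^+ (n.-1 - j) * (z ^+ i)%:P ^+ j)).
(* The root z^0 = 1 has weight 1 - z^0 = 0, which leaves the index range of [c]. *)
rewrite big_ltn // expr0 subrr scale0r add0r coef_sum mulr_sumr.
rewrite /fps_mul /fps_divX /=.
under eq_bigr => i _ do rewrite mulrCA mulr_sumr.
rewrite -mulr_sumr exchange_big -mulr_sumr /=; congr (_ * _).
rewrite big_seq_cond [RHS]big_seq_cond; apply: eq_bigr => i.
rewrite andbT mem_index_iota => /andP[i0 ltin].
rewrite coefZ -(geometric_mul_linear _ _ lambda); last first.
  by rewrite -(prim_order_dvd z_prim) gtnNdvd.
apply: eq_bigr => j _; congr (_ * _).
(* As (z^i)^n = 1, the cofactor times w - z^i is w^n - (z^i)^n = w^n - 1. *)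
rewrite fps_binpow_nat // -/w mulrC -subrXX -rmorphXn exprAC.
by rewrite (prim_expr_order z_prim) expr1n coefB coef1.
Qed.

Lemma prim_root_sum_dbernoulli s :
  \sum_(1 <= i < n) 1 / (1 - z ^+ i) ^+ s =
  (-1) ^+ s * n%:R ^+ s.+1 / (s.+1)`!%:R *
     (dbernoulli s.+1 ((n%:R - 1) / n%:R) (1 / n%:R) -
      dbernoulli s.+1 0 (1 / n%:R)).
Proof.
have l0 : lambda != 0 by rewrite invr_eq0.
have fact0 k : k`!%:R != 0 :> K by rewrite pnatr_eq0 -lt0n fact_gt0.
rewrite div1r -/lambda.
(* By [prim_root_gf], adding [c] to the generating function at 0 gives the one at (n - 1) / n, so
   uniqueness identifies the coefficients. *)
have <- : dbernoulli s.+1 0 lambda + (s.+1)`!%:R * c s.+1 =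
          dbernoulli s.+1 ((n%:R - 1) / n%:R) lambda.
  apply: (dbernoulli_unique
    (b := fun k => dbernoulli k 0 lambda + k`!%:R * c k)) => // k.
  transitivity (fps_mulX (fps_binpow lambda (0 / lambda)) k +
    fps_mulX (fps_sub (fps_binpow lambda ((n%:R - 1) / n%:R / lambda))
                      (fps_binpow lambda (0 / lambda))) k); last first.
    by case: k => [|k] /=; rewrite ?addr0 // /fps_sub addrC subrK.
  rewrite -dbernoulli_gf // -prim_root_gf -big_split; apply: eq_bigr => i _ /=.
  rewrite -mulrDr /fps_egf; congr (_ * _).
  by rewrite mulrDl [_`!%:R * _]mulrC mulfK.
rewrite addrAC subrr add0r mulrA divfK // /c /= mulrA mulr_sumr.
apply: eq_bigr => i _; rewrite div1r mulNr (exprNn (lambda / _)) exprMn !exprVn.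
set sg := (-1) ^+ s; have sg2 : sg * sg = 1 by rewrite -expr2 sqrr_sign.
set y := _^-1.
(* The prefactor (-1)^s n^(s+1) cancels the sign and the s + 1 factors [lambda] in the coefficient:
   s from the geometric ratio and one from the definition of [c]. *)
transitivity (sg * sg * (n%:R * lambda) ^+ s.+1 * y); last first.
  by rewrite exprMn !exprS exprVn; ring.
by rewrite sg2 divff // expr1n !mul1r.
Qed.

End RootsOfUnityExpansion.

Lemma zeta_root_exp (R : realType) n i :
  zeta_root R n ^+ i =
  cos (2 * pi / n%:R * i%:R) +i* sin (2 * pi / n%:R * i%:R).
Proof.
rewrite zeta_rootE; set a := 2 * pi / _.
elim: i => [|i IHi]; first by rewrite mulr0 cos0 sin0.
rewrite exprSr IHi -natr1 mulrDr mulr1 cosD sinD.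
by apply/eqP; rewrite eq_complex /= eqxx [X in _ == X]addrC eqxx.
Qed.

Lemma zeta_root_prim (R : realType) n :
  (0 < n)%N -> n.-primitive_root (zeta_root R n).
Proof.
move=> n0; have nR : 0 < n%:R :> R by rewrite ltr0n.
have zn : zeta_root R n ^+ n = 1.
  by rewrite zeta_root_exp divfK ?gt_eqF // mulr_natl cos2pi sin2pi.
have [m m_prim mn] := prim_order_exists n0 zn.
suff mE : m = n by rewrite -{1}mE.
apply/eqP; apply: contraT => m_neq.
have m0 := prim_order_gt0 m_prim.
have ltmn : (m < n)%N by rewrite ltn_neqAle m_neq dvdn_leq.
have := prim_expr_order m_prim; rewrite zeta_root_exp => -[+ _].
(* For an order m < n, half the angle lies strictly between 0 and pi. Its sine is then positive, so
   the cosine 1 - 2 sin^2 of the full angle is below 1, a contradiction. *)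
have -> : 2 * pi / n%:R * m%:R = (pi / n%:R * m%:R) *+ 2 :> R.
  by rewrite -[RHS]mulr_natl !mulrA.
have /sin_gt0_pi : 0 < (pi / n%:R * m%:R : R) < pi.
  rewrite mulr_gt0 ?divr_gt0 ?pi_gt0 ?ltr0n //= mulrAC.
  by rewrite ltr_pdivrMr // ltr_pM2l ?pi_gt0 // ltr_nat.
rewrite cos_mulr2n cos2sin2 => s0.
nra.
Qed.

Theorem theorem3 (R : realType) (n s : nat) (hn : (0 < n)%N) (hs : (0 < s)%N) :
  cyclotomic_sum n (zeta_root R n) s =
    ((-1) ^+ s * n%:R ^+ s.+1 / (s.+1)`!%:R *
     (dbernoulli s.+1 ((n%:R - 1) / n%:R) (1 / n%:R) -
      dbernoulli s.+1 0 (1 / n%:R)) : R)%:C.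
Proof.
have l0 : 1 / n%:R != 0 :> R by rewrite div1r invr_eq0 pnatr_eq0 -lt0n.
rewrite /cyclotomic_sum prim_root_sum_dbernoulli ?zeta_root_prim //.
(* The sum is now expressed by degenerate Bernoulli numbers over [R[i]]; moving the embedding inward
   on the right reaches the same expression. *)
rewrite -[RHS]/(real_complex R _) rmorphM rmorphB !rmorph_dbernoulli //.
rewrite !fmorph_div rmorphB rmorphM rmorph0 rmorph1 !rmorphXn rmorphN.
by rewrite rmorph1 !rmorph_nat.
Qed.
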